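(* For each (small) $h>0$ let $u_h$ be a mesh function on $\mathcal{N}_h$, and assume that $|u_h|\le M$ on $\mathcal{N}_h$ for a constant $M$ independent of $h$. Then there is a sequence $h_k\to0$ such that $\Gamma(u_{h_k})$ converges uniformly on compact subsets of $\Omega$ to a convex function $v$ on $\Omega$.
   Context: $\Omega\subset\mathbb{R}^d$ is a nonempty bounded convex domain (open) with boundary $\partial\Omega$. For $h>0$: $\mathbb{Z}^d_h=\{mh: m\in\mathbb{Z}^d\}$ and $\Omega_h=\Omega\cap\mathbb{Z}^d_h$; $h$ is always small enough that $\Omega_h\neq\emptyset$. $(r_1,\dots,r_d)$ is the canonical basis of $\mathbb{R}^d$. For $x\in\Omega_h$ and $e\in\mathbb{Z}^d$, $h^e_x=\sup\{rh: r\in[0,1],\ x+rhe\in\overline{\Omega}\}$. $V\subset\mathbb{Z}^d\setminus\{0\}$ is a fixed set of directions containing $r_1,\dots,r_d$, with $-e\in V$ whenever $e\in V$, and such that each $e\in V$ is the first element of some basis of $\mathbb{Z}^d$ (the choice $V=\mathbb{Z}^d\setminus\{0\}$ is also allowed). $\partial\Omega_h=\{x\in\partial\Omega: x=y+h^e_y e \text{ for some } y\in\Omega_h, e\in V\}$, $\mathcal{N}_h=\Omega_h\cup\partial\Omega_h$. A mesh function is a function $u_h:\mathcal{N}_h\to\mathbb{R}$. The convex envelope of $u_h$ is $\Gamma(u_h)(x)=\sup\{L(x): L \text{ affine}, L(y)\le u_h(y)\ \forall y\in\mathcal{N}_h\}$. It is considered on the convex hull $\operatorname{Conv}(\mathcal{N}_h)$,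 which contains any given compact subset of $\Omega$ for $h$ small enough, so uniform convergence on compact subsets of $\Omega$ is meaningful. *)

(* Defs.v *)
From HB Require Import structures.
From mathcomp Require Import all_boot all_order all_algebra.
From mathcomp Require Import all_classical all_reals all_analysis.

Set Implicit Arguments.
Unset Strict Implicit.
Unset Printing Implicit Defensive.

Import Order.TTheory GRing.Theory Num.Theory.
Import numFieldNormedType.Exports.

Local Open Scope classical_set_scope.
Local Open Scope ring_scope.

(* R^d is 'rV[R]_d (its norm is the sup norm, which induces the usual topology)
   and Z^d is 'rV[int]_d. *)

Definition toR (R : realType) (d : nat) (m : 'rV[int]_d) : 'rV[R]_d :=
  map_mx intr m.

Definition Zbasis (d : nat) (b : 'I_d -> 'rV[int]_d) : Prop :=
  forall z : 'rV[int]_d, exists! c : 'rV[int]_d, z = \sum_(i < d) c 0 i *: b i.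

Definition first_of_Zbasis (d : nat) (e : 'rV[int]_d) : Prop :=
  exists b : 'I_d -> 'rV[int]_d,
    Zbasis b /\ forall i : 'I_d, i = 0%N :> nat -> b i = e.

(* The set of all nonzero vectors is allowed separately because, for instance,
   2 r_1 is not an element of any basis of Z^d. *)
Definition admissible_directions (d : nat) (V : set 'rV[int]_d) : Prop :=
  [/\ forall e, V e -> e <> 0,
      forall i : 'I_d, V (delta_mx 0 i),
      forall e, V e -> V (- e)
    & (forall e, V e -> first_of_Zbasis e) \/ V = [set e | e <> 0]].

Definition boundary (T : topologicalType) (A : set T) : set T :=
  closure A `\` A°.

Definition grid {R : realType} {d : nat} (h : R) : set 'rV[R]_d :=
  [set h *: toR R m | m in [set: 'rV[int]_d]].

Section mesh.
Context (R : realType) (d : nat).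
Implicit Types (Omega : set 'rV[R]_d) (V : set 'rV[int]_d) (h : R).

Definition interior_mesh Omega h : set 'rV[R]_d := Omega `&` grid h.

Definition step Omega h (x : 'rV[R]_d) (e : 'rV[int]_d) : R :=
  sup [set r * h | r in [set r : R | 0 <= r <= 1 /\
                                     closure Omega (x + (r * h) *: toR R e)]].

Definition boundary_mesh V Omega h : set 'rV[R]_d :=
  [set x | boundary Omega x /\
     exists y e, [/\ interior_mesh Omega h y, V e
                   & x = y + step Omega h y e *: toR R e]].

Definition mesh V Omega h : set 'rV[R]_d :=
  interior_mesh Omega h `|` boundary_mesh V Omega h.

Definition affine (L : 'rV[R]_d -> R) : Prop :=
  exists (l : {scalar 'rV[R]_d}) (c : R), forall x, L x = l x + c.

Definition conv_hull (A : set 'rV[R]_d) : set 'rV[R]_d :=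
  smallest (@convex_set R 'rV[R]_d) A.

(* Only the values of u on N matter. The real-valued [sup] is the true supremum
   when x is in [conv_hull N] and u is bounded below on N; if the set of values
   is unbounded, [sup] is 0 by convention. *)
Definition convex_envelope (N : set 'rV[R]_d) (u : 'rV[R]_d -> R)
    (x : 'rV[R]_d) : R :=
  sup [set L x | L in [set L | affine L /\ forall y, N y -> L y <= u y]].

End mesh.

(* Main.v *)
Require Import Defs.
From mathcomp Require Import all_boot all_order all_algebra.
From mathcomp Require Import all_classical all_reals all_analysis.
From mathcomp Require Import lra ring.
Import Order.TTheory GRing.Theory Num.Theory.
Import numFieldNormedType.Exports.

Local Open Scope classical_set_scope.
Local Open Scope ring_scope.

(** The envelope of a mesh function bounded by [M] is convex and bounded by [M]
    on the convex hull of the mesh: the constant [- M] is a minorant, and an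
    affine minorant is at most [M] on the mesh, hence on its hull
    ([convex_envelope_bounded], [convex_envelope_convex]).  Once [h] is smaller
    than the distance of a point to the complement of [Omega], the grid cell
    around that point has its vertices in [Omega], so a neighbourhood of every
    point of [Omega] is eventually contained in the hull
    ([near_conv_hull_mesh]).

    Convex functions bounded by [M] on a ball are Lipschitz on the ball of half
    the radius, with a constant depending only on [M] and the radius
    ([bounded_convex_lipschitz]), so the envelopes are locally equi-Lipschitz
    and a compactness argument applies.  The usual diagonal extraction over a
    countable dense set is replaced by an ultrafilter [U] on the mesh sizes that
    refines the filter of right neighbourhoods of [0]: along [U] every bounded
    real family converges, so [v x] is simply the limit along [U] of the
    envelopes at [x].  The equi-Lipschitz bound makes the convergence to [v]
    locally uniform in [x], hence uniform on compact sets
    ([ultra_convex_cvg]).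

    A genuine sequence comes back at the end: exhaust [Omega] by compact sets
    [K n] ([compact_exhaustion]).  For each [n], the mesh sizes below
    [1 / (n+1)] whose hull contains [K n] and whose envelope is within
    [1 / (n+1)] of [v] on [K n] form a set in [U], in particular a nonempty
    one; take [h_ n] in it. *)

(** * Segments and boxes in convex sets *)

(** The next four lemmas trade the bundled weights of type [{i01 R}] for a
    real [t] with bounds, so that weights can be computed with. *)
Lemma convex_set_comb {R : numDomainType} {E : lmodType R} {A : set E} :
  @convex_set R E A -> forall (x y : E) (t : R), 0 <= t -> t <= 1 ->
  A x -> A y -> A (t *: x + (1 - t) *: y).
Proof.
move=> cA x y t t0 t1 Ax Ay.
by have := cA x y (Itv01 t0 t1); rewrite !inE; apply.
Qed.

Lemma comb_convex_set {R : numDomainType} {E : lmodType R} {A : set E} :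
  (forall (x y : E) (t : R), 0 <= t -> t <= 1 ->
    A x -> A y -> A (t *: x + (1 - t) *: y)) -> @convex_set R E A.
Proof. by move=> cA x y t; rewrite !inE => Ax Ay; exact: cA. Qed.

Lemma convex_function_comb {R : numFieldType} {E : lmodType R} {A : set E}
    {f : E -> R} :
  @convex_function R E A f -> forall (x y : E) (t : R), 0 <= t -> t <= 1 ->
  A x -> A y -> f (t *: x + (1 - t) *: y) <= t * f x + (1 - t) * f y.
Proof.
move=> cf x y t t0 t1 Ax Ay.
by have := cf (Itv01 t0 t1) x y; rewrite !inE; apply.
Qed.

Lemma comb_convex_function {R : numFieldType} {E : lmodType R} {A : set E}
    {f : E -> R} :
  (forall (x y : E) (t : R), 0 <= t -> t <= 1 ->
    A x -> A y -> f (t *: x + (1 - t) *: y) <= t * f x + (1 - t) * f y) ->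
  @convex_function R E A f.
Proof. by move=> cf t x y; rewrite !inE => Ax Ay; exact: cf. Qed.

(** The coordinates are released one at a time: a point whose coordinate [k] is
    strictly between [a] and [b] lies on the segment joining the two points
    where that coordinate is moved to [a] and to [b]. *)
Lemma convex_set_box {R : realFieldType} {d : nat} (C : set 'rV[R]_d)
    (a b : 'rV[R]_d) :
  @convex_set R 'rV[R]_d C ->
  (forall z : 'rV[R]_d, (forall i, z 0 i = a 0 i \/ z 0 i = b 0 i) -> C z) ->
  forall y : 'rV[R]_d, (forall i, a 0 i <= y 0 i <= b 0 i) -> C y.
Proof.
move=> cC vC.
(* The induction is on the number [n] of initial coordinates that are free in
   the box, the others being at an end of their interval. *)
suff H (n : nat) (y : 'rV[R]_d) : (forall i, a 0 i <= y 0 i <= b 0 i) ->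
    (forall i : 'I_d, (n <= i)%N -> y 0 i = a 0 i \/ y 0 i = b 0 i) -> C y.
  move=> y yab; apply: (H d) => // i.
  by rewrite leqNgt ltn_ord.
elim: n y => [|n IH] y yab yv.
  by apply: vC => i; exact: yv.
have [nd|dn] := ltnP n d; last first.
  by apply: IH => // i /(leq_trans dn); rewrite leqNgt ltn_ord.
pose k := Ordinal nd.
pose set_k (c : R) : 'rV[R]_d := \row_i if i == k then c else y 0 i.
have Cset c : c = a 0 k \/ c = b 0 k -> C (set_k c).
  move=> cab; apply: IH => [i|i ni]; rewrite mxE.
    case: eqP => // ->; have := yab k.
    by case: cab => ->; lra.
  case: eqP => [->//|/eqP ik]; apply: yv.
  rewrite ltn_neqAle ni andbT eq_sym; apply: contra ik => /eqP ik.
  exact/eqP/val_inj.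
have := yab k; have [/eqP ab|ab] := boolP (b 0 k - a 0 k == 0) => yk.
  have -> : y = set_k (a 0 k); last by apply: Cset; left.
  apply/rowP => i; rewrite mxE; case: eqP => // ->; lra.
pose t := (b 0 k - y 0 k) / (b 0 k - a 0 k).
have ab0 : 0 < b 0 k - a 0 k by rewrite lt_neqAle eq_sym ab/=; lra.
have t0 : 0 <= t by rewrite divr_ge0 //; lra.
have t1 : t <= 1 by rewrite ler_pdivrMr //; lra.
have -> : y = t *: set_k (a 0 k) + (1 - t) *: set_k (b 0 k).
  apply/rowP => i; rewrite !mxE; case: eqP => [->|_]; last by ring.
  by rewrite /t; field.
by apply: (convex_set_comb cC) => //; apply: Cset; [left|right].
Qed.

(** * Convex hull of the mesh *)

Lemma sub_conv_hull {R : realType} {d : nat} (A : set 'rV[R]_d) :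
  A `<=` conv_hull A.
Proof. exact: sub_smallest. Qed.

Lemma conv_hull_convex {R : realType} {d : nat} (A : set 'rV[R]_d) :
  @convex_set R 'rV[R]_d (conv_hull A).
Proof.
apply: comb_convex_set => x y t t0 t1 hx hy B [cB AB].
by apply: (convex_set_comb cB) => //; [apply: hx|apply: hy].
Qed.

(** A point [y] of [Omega] lies in its grid cell, whose vertices are at distance
    at most [h] from [y]; if [h] is small enough they are interior mesh points
    and [y] is in their convex hull. *)
Lemma near_conv_hull_mesh {R : realType} {d : nat} (V : set 'rV[int]_d)
    (Omega : set 'rV[R]_d) : open Omega -> forall x, Omega x ->
  \forall y \near x & h \near 0^'+, conv_hull (mesh V Omega h) y.
Proof.
move=> oO x Ox.
have /nbhs_ballP[e /= e0 xe] : nbhs x Omega by apply: open_nbhs_nbhs.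
have e20 : 0 < e / 2 by rewrite divr_gt0.
near=> y h => /=.
have xy : ball x (e / 2) y by near: y; exact: nbhsx_ballx.
have h0 : 0 < h by near: h; exact: nbhs_right_gt.
have he : h < e / 2 by near: h; exact: nbhs_right_lt.
(* [a] and [b] are the lower and upper corners of the grid cell of [y]. *)
pose m i : int := Num.floor (y 0 i / h).
pose a : 'rV[R]_d := \row_i (h * (m i)%:~R).
pose b : 'rV[R]_d := \row_i (h * (m i)%:~R + h).
have ayb i : a 0 i <= y 0 i < b 0 i.
  rewrite !mxE; have := floor_itv (y 0 i / h); rewrite -/(m i).
  rewrite ler_pdivlMr// ltr_pdivrMr// rmorphD/= mulrDl mul1r.
  by rewrite mulrC.
apply: (convex_set_box _ a b); first exact: conv_hull_convex.
  move=> z zab; apply: sub_conv_hull; left; split.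
    apply: xe.
    rewrite (splitr e); apply: ball_triangle xy _.
    split => // i j; rewrite ord1 -ball_normE /= ltr_norml.
    by have := ayb j; have [] := zab j => ->; rewrite !mxE; lra.
  exists (\row_i (if z 0 i == a 0 i then m i else m i + 1)) => //.
  apply/rowP => i; rewrite !mxE; case: eqP => [->//|zai].
  case: (zab i) => [|->]; first by rewrite mxE.
  rewrite mxE rmorphD/=; ring.
by move=> i; have /andP[-> /ltW ->] := ayb i.
Unshelve. all: by end_near. Qed.

(** * The convex envelope *)

Lemma affine_comb {R : realType} {d : nat} (L : 'rV[R]_d -> R) (x y : 'rV[R]_d)
    (t : R) : affine L ->
  L (t *: x + (1 - t) *: y) = t * L x + (1 - t) * L y.
Proof.
move=> [l [c Lc]]; rewrite !Lc linearP linearZ /=; ring.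
Qed.

Section envelope.
Context {R : realType} {d : nat} (N : set 'rV[R]_d) (u : 'rV[R]_d -> R) (M : R)
  (uM : forall y, N y -> `|u y| <= M).

Let minorants (x : 'rV[R]_d) : set R :=
  [set L x | L in [set L | affine L /\ forall y, N y -> L y <= u y]].

Let minorant_cst x : minorants x (- M).
Proof.
exists (fun=> - M) => //; split.
  exists (\0 : {scalar 'rV[R]_d}), (- M) => y /=; by rewrite add0r.
by move=> y /uM; rewrite ler_norml => /andP[].
Qed.

Let minorant_le x : conv_hull N x -> ubound (minorants x) M.
Proof.
move=> Nx _ [L [aL Lu] <-].
(* The convex set where [L <= M] contains [N], hence its hull. *)
suff : [set y | L y <= M] x by [].
apply: Nx; split.
  apply: comb_convex_set => y z t t0 t1 /= Ly Lz.
  rewrite affine_comb//.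
  apply: (@le_trans _ _ (t * M + (1 - t) * M)); last by lra.
  by rewrite lerD // ler_wpM2l // subr_ge0.
move=> y Ny /=; apply: le_trans (Lu _ Ny) _.
exact: le_trans (ler_norm _) (uM _ Ny).
Qed.

Let has_sup_minorants x : conv_hull N x -> has_sup (minorants x).
Proof.
move=> Nx; split; first by exists (- M); exact: minorant_cst.
by exists M; exact: minorant_le.
Qed.

Lemma convex_envelope_bounded x :
  conv_hull N x -> `|convex_envelope N u x| <= M.
Proof.
move=> Nx; rewrite ler_norml; apply/andP; split.
  by apply: (sup_upper_bound (has_sup_minorants _ Nx)); exact: minorant_cst.
by apply: ge_sup; [exists (- M); exact: minorant_cst|exact: minorant_le].
Qed.

(** A supremum of affine functions is convex wherever it is finite; outside the
    hull the set of values may be unbounded, and its real-valued supremum has no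
    meaning. *)
Lemma convex_envelope_convex :
  @convex_function R 'rV[R]_d (conv_hull N) (convex_envelope N u).
Proof.
apply: comb_convex_function => x y t t0 t1 Nx Ny.
apply: ge_sup; first by exists (- M); exact: minorant_cst.
move=> _ [L aL <-]; rewrite affine_comb; last by case: aL.
rewrite lerD // ler_wpM2l ?subr_ge0 //.
  by apply: (sup_upper_bound (has_sup_minorants _ Nx)); exists L.
by apply: (sup_upper_bound (has_sup_minorants _ Ny)); exists L.
Qed.

End envelope.

(** * Compactness of bounded families of convex functions *)

(** Prolong the segment from [z] to [y] by the length [r] beyond [y], up to a
    point [w] that is still in [S].  By convexity the slope from [z] to [y] is
    at most the slope from [z] to [w], and the rise of [f] from [z] to [w] is at
    most [2 * M]. *)
Lemma bounded_convex_lipschitz {R : realType} {E : normedModType R}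
    (S : set E) (f : E -> R) (M r : R) (x : E) :
  @convex_function R E S f -> (forall y, S y -> `|f y| <= M) -> 0 < r ->
  ball x (r + r) `<=` S ->
  forall y z, ball x r y -> ball x r z -> `|f y - f z| <= 2 * M / r * `|y - z|.
Proof.
move=> cf fM r0 xS.
have xrS y : ball x r y -> S y.
  by move=> xy; apply: xS; apply: le_ball xy; rewrite lerDl ltW.
suff H y z : ball x r y -> ball x r z -> f y - f z <= 2 * M / r * `|y - z|.
  move=> y z xy xz; rewrite ler_norml; apply/andP; split; last exact: H.
  by rewrite lerNl opprB distrC; exact: H.
move=> xy xz; have [->|yz] := eqVneq y z; first by rewrite !subrr normr0 mulr0.
pose n := `|y - z|.
have n0 : 0 < n by rewrite normr_gt0 subr_eq0.
pose w := y + (r / n) *: (y - z).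
have Sw : S w.
  apply: xS; rewrite -ball_normE /= /w opprD addrA.
  apply: le_lt_trans (ler_normB _ _) _; rewrite ltr_leD //.
    by move: xy; rewrite -ball_normE.
  have rn0 : 0 <= r / n by rewrite ltW // divr_gt0.
  by rewrite normrZ ger0_norm // -/n divfK // gt_eqF.
pose t := n / (n + r).
have nr0 : 0 < n + r by rewrite addr_gt0.
have t0 : 0 <= t by rewrite divr_ge0 // ltW.
have t1 : t <= 1 by rewrite ler_pdivrMr // mul1r lerDl ltW.
have yE : y = t *: w + (1 - t) *: z.
  have -> : 1 - t = t * (r / n) by rewrite /t; field; rewrite !gt_eqF.
  rewrite /w scalerDr scalerA scalerBr -addrA subrK -scalerDl.
  have -> : t + t * (r / n) = 1 by rewrite /t; field; rewrite !gt_eqF.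
  by rewrite scale1r.
have := convex_function_comb cf w z t t0 t1 Sw (xrS _ xz); rewrite -yE => fy.
have /ler_normlP[_ fw] := fM _ Sw.
have /ler_normlP[fz _] := fM _ (xrS _ xz).
apply: (@le_trans _ _ (t * (2 * M))).
  have : t * (f w - f z) <= t * (2 * M) by rewrite ler_wpM2l //; lra.
  by lra.
have M0 : 0 <= M by apply: le_trans (fM _ Sw).
have -> : 2 * M / r * `|y - z| = n / r * (2 * M) by rewrite -/n; ring.
rewrite ler_wpM2r ?mulr_ge0 // /t ler_pdivlMr // mulrAC ler_pdivrMr //.
by rewrite ler_pM2l // lerDr ltW.
Qed.

(** The values have a cluster point by compactness, and along an ultrafilter a
    cluster point is a limit. *)
Lemma ultra_bounded_cvg {R : realType} {I : Type} (U : set_system I)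
    (f : I -> R) (M : R) :
  UltraFilter U -> (\forall i \near U, `|f i| <= M) ->
  exists l : R, f i @[i --> U] --> l.
Proof.
move=> UU fM.
have itvfM : (f i @[i --> U]) `[- M, M]%classic.
  by apply: filterS fM => i /=; rewrite in_itv/= ler_norml.
have [l [_ cl]] := @segment_compact R (- M) M _ _ itvfM.
exists l => A lA.
have [//|UnA] := in_ultra_setVsetC (f @^-1` A) UU.
by have [x []] := cl (~` A) A UnA lA.
Qed.

Lemma cvg_to_le {R : realFieldType} {I : Type} (U : set_system I)
    {FU : ProperFilter U} (f : I -> R) (l c : R) :
  f i @[i --> U] --> l -> (\forall i \near U, f i <= c) -> l <= c.
Proof.
move=> fl fc; rewrite -(cvg_lim _ fl) //.
by apply: limr_le => //; exact: cvgP fl.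
Qed.

(** An ultrafilter form of the Arzela-Ascoli argument.  The functions [f i] are
    controlled only on sets [S i] that exhaust [Omega] along [U], because convex
    envelopes are meaningful only on the hull of their mesh. *)
Lemma ultra_convex_cvg {R : realType} {E : normedModType R} {I : Type}
    (U : set_system I) (Omega : set E) (S : I -> set E) (f : I -> E -> R)
    (M : R) :
  UltraFilter U -> open Omega -> @convex_set R E Omega ->
  (forall x, Omega x -> \forall y \near x & i \near U, S i y) ->
  (\forall i \near U, @convex_function R E (S i) (f i)) ->
  (\forall i \near U, forall x, S i x -> `|f i x| <= M) ->
  exists v : E -> R, @convex_function R E Omega v /\
    forall K, compact K -> K `<=` Omega -> forall e : R, 0 < e ->
      \forall i \near U, forall x, K x -> `|v x - f i x| < e.
Proof.
move=> UU oO cO OS cf fM.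
have Sx x : Omega x -> \forall i \near U, S i x.
  move=> /OS [[A B] /= [Ax UB] AB].
  apply: filterS UB => i Bi; apply: (AB (x, i)); split => //.
  exact: nbhs_singleton.
have /choice[v vP] x : exists l : R, Omega x -> f i x @[i --> U] --> l.
  have [Ox|nOx] := pselect (Omega x); last by exists 0.
  have [] := @ultra_bounded_cvg _ _ U (f^~ x) M UU.
    near=> i; have : S i x by near: i; exact: Sx.
    by move: (x); near: i.
  by move=> l fl; exists l.
exists v; split.
  apply: comb_convex_function => x y t t0 t1 Ox Oy.
  have Oz := convex_set_comb cO x y t t0 t1 Ox Oy.
  rewrite -subr_le0.
  have fl : f i (t *: x + (1 - t) *: y) - (t * f i x + (1 - t) * f i y)
      @[i --> U] --> v (t *: x + (1 - t) *: y) - (t * v x + (1 - t) * v y).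
    by apply: cvgB; [exact: vP|apply: cvgD; apply: cvgMl_tmp; exact: vP].
  apply: (cvg_to_le _ _ _ _ fl).
  near=> i; rewrite subr_le0.
  have Six : S i x by near: i; exact: Sx.
  have Siy : S i y by near: i; exact: Sx.
  apply: (@convex_function_comb _ _ (S i)) => //.
  by near: i.
(* Local uniformity: transfer the Lipschitz bound to the limit [v], then
   compare [v y] with [f i y] through the centre [x]. *)
have locv x : Omega x -> forall e : R, 0 < e ->
    \forall y \near x & i \near U, `|v y - f i y| < e.
  move=> Ox e e0.
  have [[A B] /= [Ax UB] AB] := OS x Ox.
  move: Ax => /nbhs_ballP[r /= r0 xA].
  pose s := r / 2.
  have s0 : 0 < s by rewrite divr_gt0.
  have xSi : \forall i \near U, ball x (s + s) `<=` S i.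
    apply: filterS UB => i Bi y xy; apply: (AB (y, i)); split => //=.
    by apply: xA; rewrite (splitr r).
  have : \forall i \near U, forall y z, ball x s y -> ball x s z ->
      `|f i y - f i z| <= 2 * M / s * `|y - z|.
    near=> i; apply: (@bounded_convex_lipschitz _ _ (S i)) => //.
    - by near: i.
    - by near: i.
    - by near: i.
  set C := 2 * M / s => lip.
  have xs : ball x s x by exact: ballxx.
  have vlip y : ball x s y -> Omega y -> `|v y - v x| <= C * `|y - x|.
    move=> xy Oy.
    have fl : `|f i y - f i x| @[i --> U] --> `|v y - v x|.
      by apply: cvg_norm; apply: cvgB; apply: vP.
    apply: (cvg_to_le _ _ _ _ fl).
    by apply: filterS lip => i; apply.
  have e30 : 0 < e / 3 by rewrite divr_gt0.
  have Cn : \forall y \near x, C * `|y - x| < e / 3.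
    have Cx : C * `|y - x| @[y --> x] --> C * `|x - x|.
      by apply: cvgMl_tmp; apply: cvg_norm; apply: cvgB => //; exact: cvg_cst.
    rewrite subrr normr0 mulr0 in Cx.
    exact: (cvgr_lt _ Cx).
  near=> y i => /=.
  have xy : ball x s y by near: y; exact: nbhsx_ballx.
  have Oy : Omega y by near: y; exact: open_nbhs_nbhs.
  have Cy : C * `|y - x| < e / 3 by near: y.
  have fx : `|v x - f i x| < e / 3.
    by near: i; move/cvgrPdist_lt : (vP x Ox); apply.
  have fxy : `|f i x - f i y| <= C * `|y - x|.
    rewrite (distrC y x).
    suff /(_ x y) : forall x' y', ball x s x' -> ball x s y' ->
      `|f i x' - f i y'| <= C * `|x' - y'| by apply.
    by near: i.
  have := vlip y xy Oy.
  have := ler_distD (v x) (v y) (f i y).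
  have := ler_distD (f i x) (v x) (f i y).
  lra.
move=> K Kco KO e e0.
have /compact_near_coveringP/(_ I U (fun i x => `|v x - f i x| < e)) := Kco.
by apply => x /KO Ox; exact: locv.
Unshelve. all: by end_near. Qed.

(** * Exhaustion by compact sets and extraction of the sequence *)

(** [K n] is the set of points at distance at least [1 / (n+1)] from the
    complement of [Omega]. *)
Lemma compact_exhaustion {R : realType} {d : nat} (Omega : set 'rV[R]_d) :
  open Omega -> bounded_set Omega ->
  exists K : nat -> set 'rV[R]_d,
    [/\ forall n, compact (K n), forall n, K n `<=` Omega
      & forall C, compact C -> C `<=` Omega -> \forall n \near \oo, C `<=` K n].
Proof.
move=> oO bO.
pose K n : set 'rV[R]_d := ~` \bigcup_(z in ~` Omega) ball z n.+1%:R^-1.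
have KO n : K n `<=` Omega.
  move=> x Kx; apply: contrapT => nOx; apply: Kx; exists x => //.
  exact: ballxx.
exists K; split => // [n|C Cco CO].
  apply: bounded_closed_compact.
    case: bO => B [rB bB]; exists B; split => // B1 /bB OB1 x /KO; exact: OB1.
  by apply: open_closedC; apply: bigcup_open => z _; exact: ball_open.
have /compact_near_coveringP/(_ nat \oo K) := Cco; apply => x Cx.
have /nbhs_ballP[e /= e0 xe] : nbhs x Omega.
  by apply: open_nbhs_nbhs; split => //; exact: CO.
have e20 : 0 < e / 2 by rewrite divr_gt0.
near=> y n => /= -[z nOz zy]; apply: nOz; apply: xe.
rewrite (splitr e); apply: (@ball_triangle _ _ y).
  by near: y; exact: nbhsx_ballx.
apply: ball_sym; apply: le_ball zy; apply: ltW.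
by near: n; exact: (near_infty_natSinv_lt (PosNum e20)).
Unshelve. all: by end_near. Qed.

Theorem theorem9 (R : realType) (d : nat) (hd : (0 < d)%N)
    (Omega : set 'rV[R]_d)
    (Omega_neq0 : Omega !=set0) (Omega_open : open Omega)
    (Omega_bounded : bounded_set Omega)
    (Omega_convex : @convex_set R 'rV[R]_d Omega)
    (V : set 'rV[int]_d) (hV : admissible_directions V)
    (h0 : R) (h0_gt0 : 0 < h0)
    (mesh_neq0 : forall h, 0 < h < h0 -> interior_mesh Omega h !=set0)
    (u : R -> 'rV[R]_d -> R) (M : R)
    (u_bounded : forall h, 0 < h < h0 ->
       forall x, mesh V Omega h x -> `|u h x| <= M) :
  exists (h_ : nat -> R) (v : 'rV[R]_d -> R),
    [/\ forall k, 0 < h_ k < h0,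
        h_ @ \oo --> 0,
        @convex_function R 'rV[R]_d Omega v,
        forall K : set 'rV[R]_d, compact K -> K `<=` Omega ->
          \forall k \near \oo, K `<=` conv_hull (mesh V Omega (h_ k))
      & {family compactly_in Omega,
           (fun k => convex_envelope (mesh V Omega (h_ k)) (u (h_ k))) @ \oo
             --> v}].
Proof.
have [U [UU U0]] := ultraFilterLemma (at_right_proper_filter (0 : R)).
pose S h := conv_hull (mesh V Omega h).
pose f h := convex_envelope (mesh V Omega h) (u h).
have Uh0 : \forall h \near U, 0 < h < h0.
  apply: U0; near=> h; apply/andP; split; near: h.
    exact: nbhs_right_gt.
  exact: nbhs_right_lt.
have hull_cover x : Omega x -> \forall y \near x & h \near U, S h y.
  move=> /(near_conv_hull_mesh V Omega Omega_open)[[A B] /= [xA B0] AB].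
  by exists (A, B) => //; split => //; exact: U0.
have [v [cv fv]] := @ultra_convex_cvg R 'rV[R]_d R U Omega S f M UU Omega_open
  Omega_convex hull_cover
  (filterS (fun h hh => @convex_envelope_convex _ _ _ _ _ (u_bounded h hh)) Uh0)
  (filterS
    (fun h hh => @convex_envelope_bounded _ _ _ _ _ (u_bounded h hh)) Uh0).
have [K [Kco KO Kex]] := compact_exhaustion Omega Omega_open Omega_bounded.
have hull_sub n : \forall h \near U, K n `<=` S h.
  have /compact_near_coveringP := Kco n; apply => x /KO.
  exact: hull_cover.
(* Each of the four conditions holds along [U], so a single [h] meets them. *)
have /choice[h_ h_P] (n : nat) : exists h, [/\ 0 < h < h0, h < n.+1%:R^-1,
    K n `<=` S h & forall x, K n x -> `|v x - f h x| < n.+1%:R^-1].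
  have n0 : 0 < n.+1%:R^-1 :> R by rewrite invr_gt0.
  suff /filter_ex : \forall h \near U, [/\ 0 < h < h0, h < n.+1%:R^-1,
    K n `<=` S h & forall x, K n x -> `|v x - f h x| < n.+1%:R^-1] by [].
  near=> h; split; near: h => //.
    by apply: U0; exact: nbhs_right_lt.
  exact: fv.
exists h_, v; split => //.
- by move=> k; have [] := h_P k.
- apply/cvgrPdist_lt => e e0; near=> n.
  have [/andP[hn _] hn1 _ _] := h_P n.
  rewrite sub0r normrN gtr0_norm //; apply: lt_trans hn1 _.
  by near: n; exact: (near_infty_natSinv_lt (PosNum e0)).
- move=> C Cco CO; have := Kex C Cco CO.
  by apply: filterS => n CK; have [_ _ KS _] := h_P n; exact: subset_trans KS.
- apply/fam_cvgP => A [AO Aco] P /uniform_nbhs[E [entE EP]].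
  move: entE; rewrite -entourage_ballE => -[e /= e0 eE].
  near=> n; apply: EP => x Ax; apply: eE; rewrite /= -ball_normE /=.
  have [_ _ _ fn] := h_P n.
  apply: (@lt_trans _ _ n.+1%:R^-1).
    by apply: fn; move: x Ax; near: n; exact: Kex.
  by near: n; exact: (near_infty_natSinv_lt (PosNum e0)).
Unshelve. all: by end_near. Qed.
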